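(* Let $f,h:X\to\mathbb{R}\cup\{\infty\}$ satisfy the standing assumptions in the context. Let $\alpha_k\in[0,1]$, $k=0,1,2,\dots$, and let $(x_k,u_k,s_k,z_k)$, $k=0,1,2,\dots$, be the iterates generated by the primal-dual hybrid algorithm (defined in the context) with step sizes $\alpha_k$, started from $x_0\in\operatorname{dom}(\partial f)$, $u_0\in-\operatorname{dom}(\partial h^* )$. If $\alpha_0=1$, then for all $k=1,2,\dots$ $$f(x_k)+h(x_k)+f^*(u_k)+h^*(-u_k)=\sum_{i=0}^{k-1}\mu_i^k\bigl(\mathcal{D}_{f,h}(x_i,s_i,\alpha_i)+\mathcal{D}_{h^*,\tilde f^*}(-u_i,-z_i,\alpha_i)\bigr).$$
   Context: Setting. $X$ is a finite-dimensional real vector space with dual $X^*$ and pairing $\langle\cdot,\cdot\rangle$. $f,h:X\to\mathbb{R}\cup\{\infty\}$ are proper closed convex functions with Fenchel conjugates $f^*,h^*:X^*\to\mathbb{R}\cup\{\infty\}$. $\operatorname{dom}(\partial f)\subseteq X$ and $\operatorname{dom}(\partial h^* )\subseteq X^*$ are the sets of points at which the respective subdifferential is nonempty. Single-valued oracles are fixed: for each $y\in\operatorname{dom}(\partial f)$, $\partial f(y)\in X^*$ denotes one fixed chosen element of $\operatorname{argmax}_{v\in X^*}\{\langle v,y\rangle-f^*(v)\}$ (the subdifferential of $f$ at $y$); for each $u\in\operatorname{dom}(\partial h^* )$, $\partial h^*(u)\in X$ denotes one fixed chosen element of $\operatorname{argmax}_{x\in X}\{\langle u,x\rangle-h(x)\}$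 (the subdifferential of $h^*$ at $u$). Standing assumption: $-\partial f(y)\in\operatorname{dom}(\partial h^* )$ for all $y\in\operatorname{dom}(\partial f)$, and $\partial h^*(u)\in\operatorname{dom}(\partial f)$ for all $u\in\operatorname{dom}(\partial h^* )$. Generalized Bregman distances: $D_f(y,x)=f(y)-f(x)-\langle\partial f(x),y-x\rangle$ for $x\in\operatorname{dom}(\partial f)$, $y\in\operatorname{dom}(f)$, and $D_{h^*}(v,u)=h^*(v)-h^*(u)-\langle v-u,\partial h^*(u)\rangle$ for $u\in\operatorname{dom}(\partial h^* )$, $v\in\operatorname{dom}(h^* )$, with the chosen subgradients. Notation: $\tilde f(y):=f(-y)$ (so $\tilde f^*(v)=f^*(-v)$), $$\mathcal{D}_{f,h}(x,s,\alpha):=D_f((1-\alpha)x+\alpha s,x)+h((1-\alpha)x+\alpha s)-(1-\alpha)h(x)-\alpha h(s),$$ $$\mathcal{D}_{h^*,\tilde f^*}(v,-z,\alpha):=D_{h^*}((1-\alpha)v-\alpha z,v)+f^*(-(1-\alpha)v+\alpha z)-(1-\alpha)f^*(-v)-\alpha f^*(z),$$ with the convention $0\cdot\infty=0$ (relevant only for $i=0$, $\alpha_0=1$). Primal-dual hybrid algorithm: given $x_0\in\operatorname{dom}(\partial f)$ and $u_0\in-\operatorname{dom}(\partial h^* )$, for $k=0,1,2,\dots$: $(s_k,z_k):=(\partial h^*(-u_k),\partial f(x_k))$, $(x_{k+1},u_{k+1}):=(1-\alpha_k)(x_k,u_k)+\alpha_k(s_k,z_k)$, where $\alpha_k\in[0,1]$.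 The iterates are understood to be well defined, i.e. $x_k\in\operatorname{dom}(\partial f)$ and $-u_k\in\operatorname{dom}(\partial h^* )$ for all $k$. Weights: for $k=0,1,2,\dots$, $\mu^{k+1}_k=1$ and $\mu^{k+1}_i=(1-\alpha_k)\mu^k_i$ for $i=0,\dots,k-1$. *)

(* Defs.v *)
From HB Require Import structures.
From mathcomp Require Import all_boot all_order all_algebra.
From mathcomp Require Import all_classical all_reals all_analysis.
Set Implicit Arguments.
Unset Strict Implicit.
Unset Printing Implicit Defensive.
Import Order.TTheory GRing.Theory Num.Theory.
Import numFieldNormedType.Exports.
Local Open Scope classical_set_scope.
Local Open Scope ring_scope.
Local Open Scope ereal_scope.

(* A finite-dimensional real vector space is X : vectType R with R : realType;
   its dual X^* is 'Hom(X, R^o), and pairing v x : R retypes the value v x : R^o.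
   Extended-real arithmetic has 0 * +oo = 0. *)

Definition pairing (R : realType) (X : vectType R) (v : 'Hom(X, R^o)) (x : X) :
    R := v x.

Definition proper (R : realType) (X : vectType R) (f : X -> \bar R) : Prop :=
  (forall x, f x != -oo) /\ exists x, f x < +oo.

Definition convex_efun (R : realType) (X : vectType R) (f : X -> \bar R) :
    Prop :=
  forall (x y : X) (t : R), (0 <= t <= 1)%R ->
    f ((1 - t) *: x + t *: y)%R <= (1 - t)%:E * f x + t%:E * f y.

(* vectType carries no topology: the epigraph is taken in coordinates along a
   basis, which induce on X its unique Hausdorff vector space topology. *)
Definition closed_efun (R : realType) (X : vectType R) (f : X -> \bar R) :
    Prop :=
  closed [set p : 'rV[R]_(\dim {:X}) * R |
    f (\sum_i p.1 0%R i *: (vbasis {:X})`_i)%R <= p.2%:E].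

Definition proper_closed_convex (R : realType) (X : vectType R)
    (f : X -> \bar R) : Prop :=
  [/\ proper f, closed_efun f & convex_efun f].

Definition conjugate (R : realType) (X : vectType R) (f : X -> \bar R)
    (v : 'Hom(X, R^o)) : \bar R :=
  ereal_sup [set (pairing v x)%:E - f x | x in [set: X]].

Definition argmax (R : realType) (T : Type) (g : T -> \bar R) : set T :=
  [set x | forall y, g y <= g x].

Definition subdiff (R : realType) (X : vectType R) (f : X -> \bar R) (y : X) :
    set 'Hom(X, R^o) :=
  argmax (fun v : 'Hom(X, R^o) => (pairing v y)%:E - conjugate f v).

(* The subdifferential of h^*, with X^** identified with X. *)
Definition subdiff_conj (R : realType) (X : vectType R) (h : X -> \bar R)
    (u : 'Hom(X, R^o)) : set X :=
  argmax (fun x : X => (pairing u x)%:E - h x).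

Definition dom_subdiff (R : realType) (X : vectType R) (f : X -> \bar R) :
    set X :=
  [set y | subdiff f y !=set0].

Definition dom_subdiff_conj (R : realType) (X : vectType R)
    (h : X -> \bar R) : set 'Hom(X, R^o) :=
  [set u | subdiff_conj h u !=set0].

(* The oracles are total functions, constrained only on the domains. *)
Definition oracle_subdiff (R : realType) (X : vectType R) (f : X -> \bar R)
    (df : X -> 'Hom(X, R^o)) : Prop :=
  forall y, dom_subdiff f y -> subdiff f y (df y).

Definition oracle_subdiff_conj (R : realType) (X : vectType R)
    (h : X -> \bar R) (dhs : 'Hom(X, R^o) -> X) : Prop :=
  forall u, dom_subdiff_conj h u -> subdiff_conj h u (dhs u).

Definition oracles_compatible (R : realType) (X : vectType R)
    (f h : X -> \bar R) (df : X -> 'Hom(X, R^o)) (dhs : 'Hom(X, R^o) -> X) :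
    Prop :=
  (forall y, dom_subdiff f y -> dom_subdiff_conj h (- df y)%R) /\
  (forall u, dom_subdiff_conj h u -> dom_subdiff f (dhs u)).

(* D_F(y, x) and D_{F,H}(x, s, a) for F, H : V -> \bar R whose subgradients
   live in a space W paired with V. They serve both the primal side
   (V = X, W = X^* ) and the dual side (V = X^*, W = X). *)
Definition bregman (R : realType) (V : vectType R) (W : Type)
    (pair : W -> V -> R) (F : V -> \bar R) (dF : V -> W) (y x : V) : \bar R :=
  F y - F x - (pair (dF x) (y - x)%R)%:E.

Definition hybrid_bregman (R : realType) (V : vectType R) (W : Type)
    (pair : W -> V -> R) (F : V -> \bar R) (dF : V -> W) (H : V -> \bar R)
    (x s : V) (a : R) : \bar R :=
  bregman pair F dF ((1 - a) *: x + a *: s)%R x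
  + H ((1 - a) *: x + a *: s)%R - (1 - a)%:E * H x - a%:E * H s.

Definition primal_hybrid (R : realType) (X : vectType R)
    (f : X -> \bar R) (df : X -> 'Hom(X, R^o)) (h : X -> \bar R) :
    X -> X -> R -> \bar R :=
  hybrid_bregman (@pairing R X) f df h.

Definition reflect_fun (R : realType) (X : vectType R) (f : X -> \bar R) :
    X -> \bar R :=
  fun y => f (- y)%R.

Definition dual_hybrid (R : realType) (X : vectType R)
    (h : X -> \bar R) (dhs : 'Hom(X, R^o) -> X) (f : X -> \bar R) :
    'Hom(X, R^o) -> 'Hom(X, R^o) -> R -> \bar R :=
  hybrid_bregman (fun x v => pairing v x)
    (conjugate h) dhs (conjugate (reflect_fun f)).

Record primal_dual_hybrid (R : realType) (X : vectType R)
    (df : X -> 'Hom(X, R^o)) (dhs : 'Hom(X, R^o) -> X) (alpha : nat -> R)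
    (x s : nat -> X) (u z : nat -> 'Hom(X, R^o)) : Prop := {
  pdh_s : forall k, s k = dhs (- u k)%R;
  pdh_z : forall k, z k = df (x k);
  pdh_x : forall k, x k.+1 = ((1 - alpha k) *: x k + alpha k *: s k)%R;
  pdh_u : forall k, u k.+1 = ((1 - alpha k) *: u k + alpha k *: z k)%R
}.

(* mu^k_i, meaningful for i < k. *)
Fixpoint weight (R : realType) (alpha : nat -> R) (k i : nat) : R :=
  if k is k'.+1 then
    if i == k' then 1%R else ((1 - alpha k') * weight alpha k' i)%R
  else 0%R.

Lemma conjugate_reflect (R : realType) (X : vectType R) (f : X -> \bar R)
    (v : 'Hom(X, R^o)) :
  conjugate (reflect_fun f) v = conjugate f (- v)%R.
Proof.
rewrite /conjugate /reflect_fun /pairing; congr ereal_sup.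
apply/seteqP; split => _ [x _ <-]; exists (- x)%R => //=.
- by rewrite opp_lfunE linearN opprK.
- by rewrite opp_lfunE linearN !opprK.
Qed.

Lemma dual_hybridE (R : realType) (X : vectType R)
    (h : X -> \bar R) (dhs : 'Hom(X, R^o) -> X) (f : X -> \bar R)
    (v z : 'Hom(X, R^o)) (a : R) :
  let w := ((1 - a) *: v - a *: z)%R in
  dual_hybrid h dhs f v (- z)%R a =
  conjugate h w - conjugate h v - (pairing (w - v)%R (dhs v))%:E
  + conjugate f (- (1 - a) *: v + a *: z)%R
  - (1 - a)%:E * conjugate f (- v)%R - a%:E * conjugate f z.
Proof.
rewrite /dual_hybrid /hybrid_bregman /bregman !conjugate_reflect opprK scalerN.
by rewrite opprB scaleNr [in X in conjugate f X]addrC.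
Qed.

(* Main.v *)
(* A chosen subgradient turns Fenchel's inequality into an equality:
   f(x_k) + f^*(z_k) = <z_k, x_k> and h(s_k) + h^*(-u_k) = -<u_k, s_k>. With
   these, the k-th summand on the right-hand side telescopes to
   Phi_{k+1} - (1 - alpha_k) Phi_k, where Phi_k is the left-hand side, and
   alpha_0 = 1 removes Phi_0.

   Since the subdifferential of f is defined through f^*, the equality for f
   requires f = f^** (Fenchel-Moreau), which follows by separating points from
   the epigraph of f by means of a Euclidean projection. *)
Require Import Defs.
From mathcomp Require Import all_boot all_order all_algebra.
From mathcomp Require Import all_classical all_reals all_analysis.
From mathcomp Require Import ring lra.
Import Order.TTheory GRing.Theory Num.Theory.
Import numFieldNormedType.Exports.
Local Open Scope ring_scope.

(** * Strict separation of a point from a closed convex set *)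

(** The hyperplane passes through the point [c] of [C] nearest to [o], with normal [c - o]: moving
    from [c] towards another point of [C] cannot bring one closer to [o]. *)
Lemma closed_strict_separation (R : realType) (n : nat)
    (C : set ('rV[R]_n * R)) (o : 'rV[R]_n * R) :
  closed C -> (C !=set0)%classic ->
  (forall p q (l : R), 0 <= l <= 1 -> C p -> C q ->
    C ((1 - l) *: p.1 + l *: q.1, (1 - l) * p.2 + l * q.2)) ->
  ~ C o ->
  exists (a : 'rV[R]_n) (b c : R),
    \sum_i a 0 i * o.1 0 i + b * o.2 < c /\
    forall p, C p -> c <= \sum_i a 0 i * p.1 0 i + b * p.2.
Proof.
move=> clC [p0 Cp0] cvxC nCo.
pose N (p : 'rV[R]_n * R) := \sum_i (p.1 0 i - o.1 0 i) ^+ 2 + (p.2 - o.2) ^+ 2.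
have sqN (p : 'rV[R]_n * R) i : (p.1 0 i - o.1 0 i) ^+ 2 <= N p.
  rewrite /N (bigD1 i)//= -addrA lerDl addr_ge0 ?sqr_ge0//.
  by apply: sumr_ge0 => j _; exact: sqr_ge0.
have sqN2 (p : 'rV[R]_n * R) : (p.2 - o.2) ^+ 2 <= N p.
  by rewrite /N lerDr sumr_ge0 // => j _; exact: sqr_ge0.
have N_ge0 p : 0 <= N p by apply: le_trans (sqN2 p); rewrite sqr_ge0.
pose M := N p0.
(* The radius [1 + M] avoids a square root: [(r - m) ^+ 2 <= M] already forces [r] into [I m]. *)
pose I (m : R) := `[m - (1 + M), m + (1 + M)]%classic.
pose B :=
  ([set v : 'rV[R]_n | forall i, I (o.1 0 i) (v ord0 i)] `*` I o.2)%classic.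
have inI m r : (r - m) ^+ 2 <= M -> I m r.
  by rewrite /I/= in_itv/= => hr; apply/andP; split; have := N_ge0 p0;
     rewrite -/M => ?; nra.
have cB : compact B.
  apply: compact_setX; last exact: segment_compact.
  by apply: (@rV_compact R n (fun i => I (o.1 0 i))) => i;
    exact: segment_compact.
have cK : compact (C `&` B)%classic.
  apply: (@subclosed_compact _ _ B _ cB) => [|? []]//.
  by apply: closedI => //; exact: compact_closed.
have inB p : N p <= M -> B p.
  move=> hp; split; first by move=> i /=; apply: inI; exact: le_trans hp.
  by apply: inI; exact: le_trans hp.
have Kp0 : (C `&` B)%classic p0 by split => //; exact: inB.
have cN : continuous N.
  have sq (g : 'rV[R]_n * R -> R) :
      continuous g -> continuous (fun p => g p ^+ 2).
    move=> cg; rewrite (_ : (fun p => _) = g \* g)%R;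
      last by apply/funext => p; rewrite expr2.
    by move=> p; apply: cvgM; exact: cg.
  move=> p; apply: cvgD.
    apply: (@cvg_big _ _ _ _ _ (@add_continuous R)) => i _.
    apply: (sq (fun q : 'rV[R]_n * R => q.1 0 i - o.1 0 i)) => {}p.
    apply: cvgB; last exact: cvg_cst.
    apply: (@cvg_comp _ _ _ fst (fun q : 'rV[R]_n => q 0 i));
      first exact: cvg_fst.
    exact: coord_continuous.
  apply: (sq (fun q : 'rV[R]_n * R => q.2 - o.2)) => {}p.
  by apply: cvgB; [exact: cvg_snd|exact: cvg_cst].
have [c /set_mem [Cc Bc] cmin] :=
  compact_EVT_min (ex_intro _ _ Kp0) cK (continuous_subspaceT cN).
(* Outside the box [B], [N] exceeds [M = N p0], so the minimum over the compact part is global on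
   [C]. *)
have cminC p : C p -> N c <= N p.
  move=> Cp; have [Np|Np] := leP (N p) M.
    by apply: cmin; apply/mem_set; split => //; exact: inB.
  by apply: le_trans (ltW Np); apply: cmin; exact: mem_set.
have Nc : 0 < N c.
  rewrite lt_neqAle N_ge0 andbT; apply/eqP => Nc0; apply: nCo.
  suff <- : c = o by [].
  have z2 (r : R) : r ^+ 2 <= 0 -> r = 0.
    by move=> hr; apply/eqP; rewrite -sqrf_eq0 eq_le hr sqr_ge0.
  have e2 : c.2 = o.2.
    by apply/eqP; rewrite -subr_eq0; apply/eqP; apply: z2; rewrite Nc0 sqN2.
  have e1 : c.1 = o.1.
    apply/rowP => i; apply/eqP; rewrite -subr_eq0; apply/eqP; apply: z2.
    by rewrite Nc0 sqN.
  by rewrite (surjective_pairing c) (surjective_pairing o) e1 e2.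
(* The functional takes at [c] a value larger than at [o] by exactly [N c]. *)
exists (c.1 - o.1), (c.2 - o.2),
  (\sum_i (c.1 - o.1) 0 i * c.1 0 i + (c.2 - o.2) * c.2); split.
  rewrite -subr_gt0; congr (0 < _): Nc.
  rewrite opprD addrACA -sumrB /N; congr (_ + _); last ring.
  by apply: eq_bigr => i _; rewrite !mxE; ring.
move=> p Cp.
rewrite -subr_ge0.
set P := (X in 0 <= X).
pose Q := \sum_i (p.1 0 i - c.1 0 i) ^+ 2 + (p.2 - c.2) ^+ 2.
have Q_ge0 : 0 <= Q.
  by rewrite addr_ge0 ?sqr_ge0//; apply: sumr_ge0 => j _; exact: sqr_ge0.
have expand l :
  N ((1 - l) *: c.1 + l *: p.1, (1 - l) * c.2 + l * p.2) =
  N c + l * (2 * P + l * Q).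
  have PE : P = \sum_i (c.1 0 i - o.1 0 i) * (p.1 0 i - c.1 0 i)
             + (c.2 - o.2) * (p.2 - c.2).
    rewrite /P opprD addrACA -sumrB; congr (_ + _); last ring.
    by apply: eq_bigr => i _; rewrite !mxE; ring.
  have -> : N ((1 - l) *: c.1 + l *: p.1, (1 - l) * c.2 + l * p.2) =
    \sum_i ((c.1 0 i - o.1 0 i) ^+ 2
      + l * (2 * ((c.1 0 i - o.1 0 i) * (p.1 0 i - c.1 0 i))
             + l * (p.1 0 i - c.1 0 i) ^+ 2))
    + ((1 - l) * c.2 + l * p.2 - o.2) ^+ 2.
    by rewrite /N/=; congr (_ + _); apply: eq_bigr => i _; rewrite !mxE; ring.
  rewrite big_split/= -mulr_sumr big_split/= -!mulr_sumr /N /Q PE.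
  ring.
rewrite leNgt; apply/negP => P_lt0.
(* With this [l], [2 * P + l * Q = (1 + l) * P < 0], so by [expand] the point at parameter [l] is
   closer to [o] than [c] is. *)
pose l := - P / (Q - P).
have QP : 0 < Q - P by lra.
have l_gt0 : 0 < l by rewrite divr_gt0//; lra.
have l_le1 : l <= 1 by rewrite /l ler_pdivrMr//; lra.
have lQ : l * (Q - P) = - P by rewrite /l mulfVK// gt_eqF.
have := cminC _ (cvxC c p l _ Cc Cp).
rewrite (ltW l_gt0) l_le1 => /(_ isT).
by rewrite expand; nra.
Qed.

(** The separation is carried out in basis coordinates. The epigraph is unbounded upwards, whence
    [0 <= b]; the vertical case [b = 0] can occur only where [f y] is infinite. *)
Lemma epigraph_strict_separation (R : realType) (X : vectType R)
    (f : X -> \bar R) (y : X) (t : R) :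
  proper_closed_convex f -> (t%:E < f y)%E ->
  exists (a : 'Hom(X, R^o)) (b c : R),
    [/\ 0 <= b, pairing a y + b * t < c &
      forall x r, (f x <= r%:E)%E -> c <= pairing a x + b * r].
Proof.
move=> [[fNy [x0 fx0]] clf cvxf] tfy.
pose e := vbasis {:X}.
pose phi (v : 'rV[R]_(\dim {:X})) : X := \sum_i v 0 i *: e`_i.
pose psi (x : X) : 'rV[R]_(\dim {:X}) := \row_i coord e i x.
have psiK x : phi (psi x) = x.
  rewrite [RHS](coord_vbasis (memvf x)); apply: eq_bigr => i _.
  by rewrite mxE.
pose C := [set p : 'rV[R]_(\dim {:X}) * R | (f (phi p.1) <= p.2%:E)%E]%classic.
have [r0 fx0E] : exists r, f x0 = r%:E.
  by exists (fine (f x0)); rewrite fineK// fin_numE fNy lt_eqF.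
have [|p q l /andP[l0 l1] Cp Cq||a [b [c [oc Cc]]]] :=
    @closed_strict_separation _ _ C (psi y, t) clf.
- by exists (psi x0, r0); rewrite /C/= psiK fx0E.
- rewrite /C/=; have -> : phi ((1 - l) *: p.1 + l *: q.1) =
      (1 - l) *: phi p.1 + l *: phi q.1.
    rewrite /phi !scaler_sumr -big_split/=; apply: eq_bigr => i _.
    by rewrite !mxE !scalerA -scalerDl.
  have l01 : 0 <= l <= 1 by rewrite l0.
  apply: (le_trans (cvxf _ _ _ l01)).
  rewrite (EFinD (_ * _)) !EFinM; apply: leeD; apply: lee_wpmul2l => //.
  by rewrite lee_fin subr_ge0.
- by rewrite /C/= psiK; apply/negP; rewrite -ltNge.
pose A : 'Hom(X, R^o) := \sum_i a 0 i *: linfun (coord e i : X -> R^o).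
have AE x : pairing A x = \sum_i a 0 i * (psi x) 0 i.
  rewrite /pairing sum_lfunE; apply: eq_bigr => i _.
  by rewrite scale_lfunE lfunE mxE.
have key x r : (f x <= r%:E)%E -> c <= pairing A x + b * r.
  by move=> fxr; rewrite AE; apply: (Cc (psi x, r)); rewrite /C/= psiK.
exists A, b, c; split => //; last by rewrite AE.
rewrite leNgt; apply/negP => b_lt0.
(* If [b < 0], raising [r0] by [(|m| + 1) / - b] lowers the functional from [c + m] to
   [c + m - (|m| + 1) < c]. *)
set m := pairing A x0 + b * r0 - c.
have step_ge0 : 0 <= (`|m| + 1) / - b.
  by apply: divr_ge0; [exact: addr_ge0|rewrite oppr_ge0 ltW].
have := key x0 (r0 + (`|m| + 1) / - b).
rewrite fx0E lee_fin lerDl step_ge0 => /(_ isT).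
rewrite mulrDr invrN mulrN mulrN mulrCA divff ?lt_eqF// mulr1.
by have := ler_norm m; rewrite /m; lra.
Qed.

(** * Fenchel conjugates, biconjugation and subgradients *)

Section Conjugate.
Context {R : realType} {X : vectType R}.
Implicit Types (f : X -> \bar R) (v : 'Hom(X, R^o)) (x y : X).
Local Open Scope ereal_scope.

Lemma fenchel_young f v x : (pairing v x)%:E - f x <= conjugate f v.
Proof. by apply: ereal_sup_ubound; exists x. Qed.

Lemma conjugate_le f v (c : R) :
  (forall x r, f x <= r%:E -> (pairing v x - r <= c)%R) ->
  (forall x, f x != -oo) -> conjugate f v <= c%:E.
Proof.
move=> h fNy; apply: ge_ereal_sup => _ [x _ <-].
case fx : (f x) (fNy x) => [r| |] // _; last by rewrite leNye.
by rewrite -EFinB lee_fin h// fx.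
Qed.

Lemma conjugate_neq_ninfty f v : Defs.proper f -> conjugate f v != -oo.
Proof.
move=> [fNy [x0 fx0]]; apply/eqP => h.
have := fenchel_young f v x0; rewrite h.
by case: (f x0) (fNy x0) fx0.
Qed.

(* A nonvertical separating hyperplane gives [v] at once. A vertical one,
   [a], is tilted by a large multiple onto a nonvertical one obtained at a point
   of the domain of [f]. *)
Lemma fenchel_moreau f y (t : R) : proper_closed_convex f -> t%:E < f y ->
  exists v, t%:E < (pairing v y)%:E - conjugate f v.
Proof.
move=> fP; have [[fNy [x0 fx0]] _ _] := fP.
(* A nonvertical hyperplane below the epigraph, divided by [b], is the graph of an affine minorant
   of [f]. *)
have slope (a : 'Hom(X, R^o)) (b c : R) : (0 < b)%R ->
    (forall x r, f x <= r%:E -> (c <= pairing a x + b * r)%R) ->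
    conjugate f (- b^-1 *: a)%R <= (- (b^-1 * c))%:E.
  move=> b0 h; apply: conjugate_le => // x r /h.
  rewrite -(ler_pM2l (x := b^-1%R)) ?invr_gt0// mulrDr mulKf ?gt_eqF//.
  rewrite /pairing scale_lfunE /GRing.scale/= mulNr; lra.
move=> tfy; have [a [b [c [b0 ac hc]]]] :=
  epigraph_strict_separation _ _ _ _ _ fP tfy.
have [bE|bN0] := eqVneq b 0%R; last first.
  have {b0}bN0 : (0 < b)%R by rewrite lt_neqAle eq_sym bN0.
  exists (- b^-1 *: a)%R.
  apply: (@lt_le_trans _ _
    ((pairing (- b^-1 *: a)%R y)%:E - (- (b^-1 * c))%:E)).
    rewrite -EFinB lte_fin /pairing scale_lfunE /GRing.scale/= mulNr.
    have : (b^-1 * (pairing a y + b * t) < b^-1 * c)%R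
      by rewrite ltr_pM2l ?invr_gt0.
    by rewrite mulrDr mulKf ?gt_eqF// /pairing; lra.
  by apply: leeB => //; exact: slope.
subst b.
have fx0E : f x0 = (fine (f x0))%:E by rewrite fineK// fin_numE fNy lt_eqF.
have sx0 : (fine (f x0) - 1)%:E < f x0 by rewrite fx0E lte_fin ltrBlDr ltrDl.
have [a' [b' [c' [b'0 ac' hc']]]] :=
  epigraph_strict_separation _ _ _ _ _ fP sx0.
(* The hyperplane separates two points above the same [x0], at heights [f x0] and [f x0 - 1], so it
   is not vertical. *)
have {}b'0 : (0 < b')%R.
  have := hc' x0 (fine (f x0)); rewrite -fx0E lexx => /(_ isT).
  by move: ac'; nra.
have Cx := slope _ _ _ b'0 hc'.
set v0 := (- b'^-1 *: a')%R in Cx; set c0 := (- _)%R in Cx.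
set m := (t - (pairing v0 y - c0))%R.
pose d := (c - pairing a y)%R.
have d0 : (0 < d)%R by rewrite /d; lra.
(* Subtracting [l *: a] lifts the minorant at [y] by [l * d = |m| + 1], more than the shortfall [m];
   on the domain of [f] it can only lower it, since [c <= pairing a x] there. *)
pose l := ((`|m| + 1) / d)%R.
have l0 : (0 <= l)%R by apply: divr_ge0; [exact: addr_ge0|exact: ltW].
have ld : (l * d = `|m| + 1)%R by rewrite /l divfK// gt_eqF.
exists (v0 - l *: a)%R.
have pE x : (pairing (v0 - l *: a) x = pairing v0 x - l * pairing a x)%R.
  by rewrite /pairing add_lfunE opp_lfunE [(l *: a) x]scale_lfunE.
apply: (@lt_le_trans _ _ ((pairing (v0 - l *: a)%R y)%:E - (c0 - l * c)%:E)).
  rewrite -EFinB lte_fin pE.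
  by have := ler_norm m; rewrite /m; move: ld; rewrite /d; lra.
apply: leeB => //; apply: conjugate_le => // x r fxr; rewrite pE.
have := hc x r fxr; rewrite mul0r addr0 => cax.
have : (pairing v0 x)%:E - r%:E <= c0%:E.
  apply: le_trans Cx; apply: le_trans (fenchel_young f v0 x).
  by apply: leeB.
rewrite -EFinB lee_fin => ?; nra.
Qed.

(** The maximum attained at [v] is the biconjugate of [f] at [y], which Fenchel-Moreau identifies
    with [f y]. *)
Lemma subdiffP f v y : proper_closed_convex f -> subdiff f y v ->
  [/\ f y \is a fin_num, conjugate f v \is a fin_num &
    (fine (f y) + fine (conjugate f v) = pairing v y)%R].
Proof.
move=> fP vmax; have [[fNy _] _ _] := fP.
(* Any real [t] below [f y] yields a dual value above [t]; the maximal value at [v] is then not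
   [-oo], which excludes [conjugate f v = +oo]. *)
have [t ty] : exists t : R, t%:E < f y.
  case: (f y) (fNy y) => [r| |]// _; last by exists 0%R; rewrite ltry.
  by exists (r - 1)%R; rewrite lte_fin ltrBlDr ltrDl.
have [v1 tv1] := fenchel_moreau _ _ _ fP ty.
have fsv : conjugate f v \is a fin_num.
  have := lt_le_trans tv1 (vmax v1); rewrite fin_numE.
  have [pf _ _] := fP.
  by rewrite conjugate_neq_ninfty//; case: (conjugate f v).
move: vmax; rewrite /subdiff /argmax/= -(fineK fsv) => vmax.
have fy_le : f y <= (pairing v y - fine (conjugate f v))%:E.
  rewrite leNgt; apply/negP => /(fenchel_moreau _ _ _ fP)[v2].
  by rewrite ltNge; have := vmax v2; rewrite -EFinB => ->.
have := fenchel_young f v y; rewrite -{1}(fineK fsv).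
case: (f y) (fNy y) fy_le => [r| |]//= _; rewrite lee_fin => h1.
by rewrite -EFinB lee_fin => h2; split => //; apply/le_anti/andP; split; lra.
Qed.

(** Here [x] attains the very supremum that defines [conjugate f v]; comparison with a point of the
    domain rules out [f x = +oo]. *)
Lemma subdiff_conjP f v x : Defs.proper f -> subdiff_conj f v x ->
  [/\ f x \is a fin_num, conjugate f v \is a fin_num &
    (fine (f x) + fine (conjugate f v) = pairing v x)%R].
Proof.
move=> [fNy [x0 fx0]] xmax.
have fsv : conjugate f v = (pairing v x)%:E - f x.
  apply/eqP; rewrite eq_le fenchel_young andbT.
  by apply: ge_ereal_sup => _ [y _ <-]; exact: xmax.
have fx : f x \is a fin_num.
  rewrite fin_numE fNy/=; apply/eqP => fxy.
  have := xmax x0; rewrite fxy.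
  by case: (f x0) (fNy x0) fx0.
rewrite fsv -(fineK fx) -EFinB; split => //=; lra.
Qed.

Lemma conjugate_convex f : Defs.proper f -> convex_efun (conjugate f).
Proof.
move=> [fNy _] u v t /andP[t0 t1]; apply: ge_ereal_sup => _ [x _ <-].
case fx : (f x) (fNy x) => [r| |]// _; last by rewrite leNye.
have -> : (pairing ((1 - t) *: u + t *: v)%R x)%:E - r%:E =
    (1 - t)%:E * ((pairing u x)%:E - f x) + t%:E * ((pairing v x)%:E - f x).
  rewrite fx -!EFinB -!EFinM -EFinD; congr EFin.
  rewrite /pairing add_lfunE [((1 - t) *: u)%R x]scale_lfunE.
  rewrite [(t *: v)%R x]scale_lfunE /GRing.scale/=; ring.
apply: leeD; apply: lee_wpmul2l; rewrite ?lee_fin ?subr_ge0//;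
  exact: fenchel_young.
Qed.

End Conjugate.

(** * Finiteness along the iterates, the recurrence and the identity *)

Local Open Scope ereal_scope.

(** The alternative [t == 1] serves the first iteration, where [F x] may be infinite but has
    coefficient 0. *)
Lemma convex_fin_num (R : realType) (V : vectType R) (F : V -> \bar R)
    (x y : V) (t : R) :
  convex_efun F -> (forall w, F w != -oo) -> (0 <= t <= 1)%R ->
  (t == 1%R) || (F x \is a fin_num) -> F y \is a fin_num ->
  F ((1 - t) *: x + t *: y)%R \is a fin_num.
Proof.
move=> cF FNy t01 Fx Fy.
have [->|t1] := eqVneq t 1%R; first by rewrite subrr scale0r add0r scale1r.
rewrite (negPf t1)/= in Fx; rewrite fin_numE FNy/= -ltey.
apply: le_lt_trans (cF _ _ _ t01) _.
by rewrite -(fineK Fx) -(fineK Fy) ltry.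
Qed.

(** The weight of index [i] is the product of the later factors [1 - alpha j], as in the solution of
    a linear recurrence; [alpha 0 = 1] removes the initial value. *)
Lemma weight_unroll (R : realType) (alpha phi d : nat -> R) :
  alpha 0%N = 1%R ->
  (forall k, phi k.+1 = (1 - alpha k) * phi k + d k)%R ->
  forall k, (phi k.+1 = \sum_(i < k.+1) weight alpha k.+1 i * d i)%R.
Proof.
move=> a0 rec; elim=> [|k IHk].
  by rewrite rec a0 subrr mul0r add0r big_ord1 /= mul1r.
rewrite big_ord_recr/= eqxx mul1r rec IHk mulr_sumr; congr (_ + _)%R.
by apply: eq_bigr => i _; rewrite (ltn_eqF (ltn_ord i)) mulrA.
Qed.

Theorem theorem2 (R : realType) (X : vectType R) (f h : X -> \bar R)
    (df : X -> 'Hom(X, R^o)) (dhs : 'Hom(X, R^o) -> X)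
    (hf : proper_closed_convex f) (hh : proper_closed_convex h)
    (hdf : oracle_subdiff f df) (hdhs : oracle_subdiff_conj h dhs)
    (hcompat : oracles_compatible f h df dhs)
    (alpha : nat -> R) (halpha : forall k, (0 <= alpha k <= 1)%R)
    (x s : nat -> X) (u z : nat -> 'Hom(X, R^o))
    (hx0 : dom_subdiff f (x 0%N)) (hu0 : dom_subdiff_conj h (- u 0%N)%R)
    (hiter : primal_dual_hybrid df dhs alpha x s u z)
    (hdomx : forall k, dom_subdiff f (x k))
    (hdomu : forall k, dom_subdiff_conj h (- u k)%R)
    (halpha0 : alpha 0%N = 1%R) (k : nat) (hk : (1 <= k)%N) :
  f (x k) + h (x k) + conjugate f (u k) + conjugate h (- u k)%R =
  \sum_(i < k) (weight alpha k i)%:E *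
    (primal_hybrid f df h (x i) (s i) (alpha i)
     + dual_hybrid h dhs f (- u i)%R (- z i)%R (alpha i)).
Proof.
have [pf _ _] := hf; have [ph _ ch] := hh.
case: hiter => sE zE xE uE.
have xz j : [/\ f (x j) \is a fin_num, conjugate f (z j) \is a fin_num &
    (fine (f (x j)) + fine (conjugate f (z j)) = pairing (z j) (x j))%R].
  by rewrite zE; apply: subdiffP => //; apply: hdf.
have su j : [/\ h (s j) \is a fin_num, conjugate h (- u j)%R \is a fin_num &
    (fine (h (s j)) + fine (conjugate h (- u j)%R) =
       pairing (- u j)%R (s j))%R].
  by rewrite sE; apply: subdiff_conjP => //; apply: hdhs.
(* Only [h (x 0)] and [conjugate f (u 0)] may be infinite: the first step jumps to [s 0] and [z 0],
   where the values are finite, and convexity preserves finiteness afterwards. *)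
have first_step j : (alpha j == 1%R) || (0 < j)%N.
  by case: j => [|j]; rewrite ?halpha0 ?eqxx ?orbT.
have hx j : (0 < j)%N -> h (x j) \is a fin_num.
  elim: j => // j IHj _; rewrite xE; apply: convex_fin_num => //.
  - by case: ph.
  - by case/orP: (first_step j) => [->//|/IHj ->]; rewrite orbT.
  - by have [] := su j.
have fu j : (0 < j)%N -> conjugate f (u j) \is a fin_num.
  elim: j => // j IHj _; rewrite uE; apply: convex_fin_num => //.
  - exact: conjugate_convex.
  - by move=> w; exact: conjugate_neq_ninfty.
  - by case/orP: (first_step j) => [->//|/IHj ->]; rewrite orbT.
  - by have [] := xz j.
(* The values at [j = 0] may be infinite, but there [1 - alpha 0 = 0]. *)
have scaled (F : nat -> \bar R) j :
    (forall i, (0 < i)%N -> F i \is a fin_num) ->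
    (1 - alpha j)%:E * F j = ((1 - alpha j) * fine (F j))%:E.
  move=> finF; case/orP: (first_step j) => [/eqP->|/finF Fj].
    by rewrite subrr mul0r mul0e.
  by rewrite EFinM fineK.
(* At [j = 0], [fine] may replace infinite terms by 0; this is harmless, as [phi 0] enters only with
   the factor [1 - alpha 0 = 0]. *)
pose phi j := (fine (f (x j)) + fine (h (x j)) + fine (conjugate f (u j))
  + fine (conjugate h (- u j)%R))%R.
pose d j := (phi j.+1 - (1 - alpha j) * phi j)%R.
have dE j : primal_hybrid f df h (x j) (s j) (alpha j)
     + dual_hybrid h dhs f (- u j)%R (- z j)%R (alpha j) = (d j)%:E.
  have [fx fz fzE] := xz j; have [hs hu huE] := su j.
  have [fx1 _ _] := xz j.+1; have [_ hu1 _] := su j.+1.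
  have hx1 := hx j.+1 isT; have fu1 := fu j.+1 isT.
  rewrite dual_hybridE /primal_hybrid /hybrid_bregman /bregman -xE -zE -sE.
  have -> : ((1 - alpha j) *: - u j - alpha j *: z j = - u j.+1)%R.
    by rewrite uE scalerN opprD.
  have -> : (- (1 - alpha j) *: - u j + alpha j *: z j = u j.+1)%R.
    by rewrite uE scaleNr scalerN opprK.
  rewrite opprK (scaled (fun i => h (x i)))//.
  rewrite (scaled (fun i => conjugate f (u i)))//.
  rewrite -(fineK fx) -(fineK fz) -(fineK hs) -(fineK hu).
  rewrite -(fineK fx1) -(fineK hu1) -(fineK hx1) -(fineK fu1).
  (* The cross terms [pairing (z j) (s j)] of [p1] and [p2] cancel; the two remaining pairings are
     replaced by function values through [fzE] and [huE]. *)
  have p1 : (pairing (z j) (x j.+1 - x j) =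
      alpha j * (pairing (z j) (s j) - pairing (z j) (x j)))%R.
    rewrite xE /pairing linearB linearD !linearZ/= /GRing.scale/=; ring.
  have p2 : (pairing (- u j.+1 + u j)%R (s j) =
      - (alpha j * (pairing (z j) (s j) + pairing (- u j)%R (s j))))%R.
    rewrite uE /pairing !add_lfunE !opp_lfunE !add_lfunE.
    rewrite [((1 - alpha j) *: u j)%R (s j)]scale_lfunE.
    rewrite [(alpha j *: z j)%R (s j)]scale_lfunE /GRing.scale/=; ring.
  rewrite p1 p2 -fzE -huE -?(EFinB, EFinD, EFinM, EFinN) /d /phi; congr EFin.
  ring.
case: k hk => // k _.
under eq_bigr do rewrite dE -EFinM.
rewrite sumEFin -(weight_unroll R alpha phi)// => [|j];
  last by rewrite /d addrC subrK.
have [fx _ _] := xz k.+1; have [_ hu _] := su k.+1.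
by rewrite /phi !EFinD !fineK// ?hx ?fu.
Qed.
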